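(* Let $k$ be a field of characteristic $0$, $K$ a function field over $k$, $X$ a smooth projective curve over $K$, and let $(E,\nabla)$ be a vertical admissible connection on $X$, whose local equation (in a local basis of $E$) at a $K$-rational admissible point of multiplicity $m$ with local parameter $z$ is $$\frac{g_m\,dz}{z^m}+\frac{g_{m-1}\,dz}{z^{m-1}}+\dots+\frac{\eta_{m-1}}{z^{m-1}}+\frac{\eta_{m-2}}{z^{m-2}}+\dots,$$ with $g_j$ matrices with entries in $K$ and $\eta_j$ matrices with entries in $\Omega^1_K$. Then $$\operatorname{Tr}\Big(g_m^{-1}\sum_{s=0}^{m-1}[g_{m-s},\eta_s]\Big)=0 .$$
   Context: $\Omega^p_K=\Omega^p_{K/k}$, $\Omega^1_X$ are absolute differentials over $k$. The matrix of the connection is the displayed formal Laurent expansion in $z$, with $g_j$ (resp. $\eta_j$) the coefficient of $dz/z^{j}$ (resp. $1/z^{j}$); here $j\le m$ for $g_j$ and $j\le m-1$ for $\eta_j$, and $\eta_0$ is the constant term of the $\Omega^1_K$-part. Admissible (at this point, multiplicity $m\ge2$) means that the connection has this shape with $g_m$ an invertible matrix over $K$; at a point of multiplicity $m=1$ it means that no eigenvalue of the residue $g_1$ lies in $\{0,1,2,\dots\}$. Vertical means that the curvature $\nabla^2$ has coefficients in $\Omega^2_K\otimes K(X)$, i.e. the curvature matrix vanishes modulo $\Omega^2_K\otimes K(X)$. *)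

(* Defs.v *)
From HB Require Import structures.
From mathcomp Require Import all_boot all_order all_algebra.
From mathcomp Require Import boolp classical_sets cardinality.

Set Implicit Arguments.
Unset Strict Implicit.
Unset Printing Implicit Defensive.

Import GRing.Theory.
Local Open Scope ring_scope.
Local Open Scope classical_set_scope.

(* A smooth projective curve X over a field K of characteristic 0 is given by
   its function field L = K(X): closed points are the discrete valuation rings
   of L containing K, i.e. the local rings O_{X,p}.  A vector bundle of rank r
   is given by its generic fibre, trivialised as L^r, and its stalks, which are
   O_{X,p}-lattices in L^r. *)

(** * Function fields *)

Definition subring (F : fieldType) (S : set F) : Prop :=
  [/\ S 1, forall x y, S x -> S y -> S (x - y)
    & forall x y, S x -> S y -> S (x * y)].

Definition subfield (F : fieldType) (S : set F) : Prop :=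
  subring S /\ forall x, S x -> S x^-1.

Definition fin_gen_field (k F : fieldType) (i : k -> F) : Prop :=
  exists s : seq F, forall S : set F, subfield S ->
    (forall a, S (i a)) -> (forall x, x \in s -> S x) -> forall x, S x.

(* Transcendence degree one: some t is transcendental over K and every x is a
   root of a nonzero polynomial with coefficients in K[t]. *)
Definition transc_deg1 (K L : fieldType) (j : {rmorphism K -> L}) : Prop :=
  exists t : L, ~ algebraicOver j t /\
    forall x : L, exists2 P : {poly {poly K}}, P != 0 &
      root (map_poly (fun q : {poly K} => (map_poly j q).[t]) P) x.

Definition curve_function_field (K L : fieldType) (j : {rmorphism K -> L}) :=
  fin_gen_field j /\ transc_deg1 j.

(** * Closed points *)

Section Points.
Variables (K L : fieldType) (j : {rmorphism K -> L}).

Definition local_unit (O : set L) : set L := [set x | O x /\ exists2 y, O y & x * y = 1].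

Definition max_ideal (O : set L) : set L := [set x | O x /\ ~ local_unit O x].

Definition local_parameter (O : set L) (z : L) : Prop :=
  [/\ max_ideal O z, z != 0
    & forall x, x != 0 -> exists n : int, exists2 u, local_unit O u & x = u * z ^ n].

Definition closed_point (O : set L) : Prop :=
  [/\ subring O, forall a, O (j a) & exists z, local_parameter O z].

Definition rational_point (O : set L) : Prop :=
  closed_point O /\ forall x, O x -> exists a, max_ideal O (x - j a).

Definition mx_over (O : set L) m n (A : 'M[L]_(m, n)) := forall a b, O (A a b).

(* The columns of B form an O_{X,p}-basis of the stalk, whence B is a local
   basis of the bundle at p. *)
Definition local_basis r (E : set L -> set 'cV[L]_r) (O : set L) (B : 'M[L]_r) :=
  B \in unitmx /\ E O = [set v | exists2 u, mx_over O u & v = B *m u].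

(* The standard basis of the generic fibre is a basis of almost all stalks. *)
Definition vector_bundle r (E : set L -> set 'cV[L]_r) : Prop :=
  (forall O, closed_point O -> exists B, local_basis E O B) /\
  finite_set [set O | closed_point O /\ ~ local_basis E O 1%:M].

End Points.

(** * Differential forms *)

Definition derivation (k F : fieldType) (i : k -> F) (M : lmodType F) (D : F -> M) :=
  [/\ forall a, D (i a) = 0, forall x y, D (x + y) = D x + D y
    & forall x y, D (x * y) = x *: D y + y *: D x].

Record kaehler (k F : fieldType) (i : k -> F) := Kaehler {
  omega1 :> lmodType F;
  kd : F -> omega1;
  kd_derivation : derivation i kd;
  kd_universal : forall (M : lmodType F) (D : F -> M), derivation i D ->
    exists f : {linear omega1 -> M}, (forall x, f (kd x) = D x) /\
      forall h : {linear omega1 -> M}, (forall x, h (kd x) = D x) -> h =1 f }.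

Definition alternating_bilinear (F : fieldType) (M N : lmodType F) (b : M -> M -> N) :=
  [/\ forall a u v w, b (a *: u + v) w = a *: b u w + b v w,
      forall a u v w, b w (a *: u + v) = a *: b w u + b w v
    & forall u, b u u = 0].

Record exterior_square (F : fieldType) (M : lmodType F) := ExteriorSquare {
  ext2 :> lmodType F;
  wedge : M -> M -> ext2;
  wedge_alternating : alternating_bilinear wedge;
  wedge_universal : forall (N : lmodType F) (b : M -> M -> N),
    alternating_bilinear b ->
    exists f : {linear ext2 -> N}, (forall u v, f (wedge u v) = b u v) /\
      forall h : {linear ext2 -> N}, (forall u v, h (wedge u v) = b u v) -> h =1 f }.

(* The de Rham differential from 1-forms to 2-forms; it is unique. *)
Record exterior_derivative (k F : fieldType) (i : k -> F) (Om : kaehler i)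
    (Om2 : exterior_square Om) := ExteriorDerivative {
  ext_d :> {additive Om -> Om2};
  ext_dZ : forall a w, ext_d (a *: w) = wedge Om2 (kd Om a) w + a *: ext_d w;
  ext_d_exact : forall a, ext_d (kd Om a) = 0 }.

(* The functorial map from forms over K to forms over L; it is unique. *)
Record kaehler_map (k K L : fieldType) (i : k -> K) (i' : k -> L)
    (j : {rmorphism K -> L}) (OmK : kaehler i) (OmL : kaehler i') := KaehlerMap {
  kmap :> {additive OmK -> OmL};
  kmapZ : forall a w, kmap (a *: w) = j a *: kmap w;
  kmap_d : forall a, kmap (kd OmK a) = kd OmL (j a) }.

(** * Matrices of forms *)

Section FormMatrices.
Variables (F : fieldType) (M : lmodType F).

Definition lmulform m n p (A : 'M[F]_(m, n)) (W : 'M[M]_(n, p)) : 'M[M]_(m, p) :=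
  \matrix_(a, b) \sum_c A a c *: W c b.

Definition rmulform m n p (W : 'M[M]_(m, n)) (A : 'M[F]_(n, p)) : 'M[M]_(m, p) :=
  \matrix_(a, b) \sum_c A c b *: W a c.

Definition commform n (A : 'M[F]_n) (W : 'M[M]_n) : 'M[M]_n :=
  lmulform A W - rmulform W A.

End FormMatrices.

(** * Connections *)

Section Connections.
Variables (k K L : fieldType) (i : {rmorphism k -> K}) (j : {rmorphism K -> L}).
Variables (OmK : kaehler i) (OmL : kaehler (j \o i)).
Variables (phi : kaehler_map j OmK OmL).
Variables (Om2 : exterior_square OmL) (dR : exterior_derivative Om2).
Variable r : nat.
Implicit Types (E : set L -> set 'cV[L]_r) (O : set L) (z : L) (B : 'M[L]_r).
Implicit Types (A : 'M[OmL]_r) (nabla : {additive 'cV[L]_r -> 'cV[OmL]_r}).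

(* An absolute (k-linear) connection on the generic fibre, the forms taking
   values in L^r being column vectors of forms. *)
Definition connection nabla : Prop := forall (f : L) (v : 'cV[L]_r),
  nabla (f *: v) = \col_a (v a 0 *: kd OmL f + f *: nabla v a 0).

(* The matrix of the connection in the basis of columns e_b of B:
   nabla e_b = \sum_a e_a A_ab. *)
Definition connection_matrix nabla B A : Prop :=
  forall b, nabla (col b B) = lmulform B (col b A).

(* nabla^2, with nabla (w (x) v) = d w (x) v - w /\ nabla v on 1-forms. *)
Definition curvature nabla (v : 'cV[L]_r) : 'cV[Om2]_r :=
  \col_a (dR (nabla v a 0) -
          \sum_b wedge Om2 (nabla v b 0) (nabla (delta_mx b 0) a 0)).

(* The image of the tensor product of the 2-forms of K with L. *)
Definition base_2forms : set Om2 :=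
  [set w | exists n, exists c : 'I_n -> L, exists u v : 'I_n -> OmK,
     w = \sum_l c l *: wedge Om2 (phi (u l)) (phi (v l))].

Definition vertical nabla : Prop :=
  forall v a, base_2forms (curvature nabla v a 0).

(* The stalk of the absolute differentials of X, inside those of L. *)
Definition omega_stalk O : set OmL :=
  [set w | exists n, exists f g : 'I_n -> L,
     [/\ forall l, O (f l), forall l, O (g l) & w = \sum_l f l *: kd OmL (g l)]].

(* The O_{X,p}-submodule z^n * Omega^1_{X,p}. *)
Definition omega_filtration O z (n : int) : set OmL :=
  [set w | exists2 w', omega_stalk O w' & w = z ^ n *: w'].

Definition regular_at E nabla O : Prop :=
  exists B, exists A, [/\ local_basis E O B, connection_matrix nabla B A
    & forall a b, omega_stalk O (A a b)].

(* Conditions on the reduction of G modulo the maximal ideal. *)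
Definition residually_invertible O (G : 'M[L]_r) : Prop :=
  local_unit O (\det G).

Definition residual_eigenvalue O (G : 'M[L]_r) (c : L) : Prop :=
  exists v : 'rV[L]_r, [/\ mx_over O v, ~ mx_over (max_ideal O) v
    & mx_over (max_ideal O) (v *m G - c *: v)].

(* Admissibility at an arbitrary closed point.  G is determined modulo the
   maximal ideal; at a rational point its reduction is the matrix g_m. *)
Definition admissible_at E nabla O (m : nat) : Prop :=
  exists z, exists B, exists A, exists G : 'M[L]_r,
  [/\ local_parameter O z, local_basis E O B, connection_matrix nabla B A,
      mx_over O G /\ (forall a b,
        omega_filtration O z (1 - m%:Z)
          (A a b - (G a b * z ^ (- m%:Z)) *: kd OmL z))
    & ((2 <= m)%N /\ residually_invertible O G) \/
      (m = 1%N /\ forall n : nat, ~ residual_eigenvalue O G n%:R)].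

Definition admissible E nabla : Prop := forall O, closed_point j O ->
  regular_at E nabla O \/ exists m, admissible_at E nabla O m.

(* A = \sum_(l <= m) g_l dz / z^l + \sum_(l <= m - 1) eta_l / z^l as a formal
   Laurent series, i.e. modulo z^n * Omega^1_{X,p} for every n. *)
Definition local_equation O z A (m : nat) (g : int -> 'M[K]_r)
    (eta : int -> 'M[OmK]_r) : Prop :=
  forall (N : nat) a b, omega_filtration O z (N%:Z - m%:Z)
    (A a b
     - \sum_(l < N) (j (g (m%:Z - l%:Z) a b) * z ^ (l%:Z - m%:Z)) *: kd OmL z
     - \sum_(l < N) z ^ (l%:Z - (m%:Z - 1)) *: phi (eta (m%:Z - 1 - l%:Z) a b)).

(* Admissibility of the leading coefficient g_m at a rational point. *)
Definition admissible_leading (m : nat) (gm : 'M[K]_r) : Prop :=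
  ((2 <= m)%N /\ gm \in unitmx) \/
  (m = 1%N /\ forall n : nat, ~~ eigenvalue gm n%:R).

End Connections.

(* Main.v *)
(* Expand the curvature dA + A /\ A along Spec K((z)).  For m < l < 2m its
   component along dz / z^l is the sum of the [g_i, eta_s] with i + s = l, because
   dg_l and (l - 1) eta_(l-1) vanish; verticality makes it zero.  Put
   G = sum_s g_(m-s) z^s and H = sum_s eta_(m-1-s) z^s: then [G, H] = C z^(m-1) + ...
   with C the sum of the [g_(m-s), eta_s].  Since adj G commutes with G,
   Tr (adj G [G, H]) = 0, whose lowest coefficient is det g_m Tr (g_m^-1 C).

   To extract coefficients from forms that are only known through universal
   properties, h, f, g |-> Res (h dg /\ df), where Res takes Laurent series to
   OmK by differentiating the coefficients of f, is shown to be a derivation in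
   f and in g; it therefore extends to a linear map on the 2-forms of L, which
   kills the 2-forms coming from K. *)
Require Import Defs.
From HB Require Import structures.
From mathcomp Require Import all_boot all_order all_algebra.
From mathcomp Require Import boolp classical_sets cardinality.
From mathcomp Require Import zify ring.

Set Implicit Arguments.
Unset Strict Implicit.
Unset Printing Implicit Defensive.

Import Order.TTheory GRing.Theory Num.Theory.
Local Open Scope ring_scope.
Local Open Scope classical_set_scope.

(** * Sums over the integers *)

Section IntSum.
Variable V : zmodType.
Implicit Types F G : int -> V.

(** Since [Negz l] is -(l + 1), the indices run over -n <= l < n. *)
Definition int_psum F (n : nat) : V := \sum_(l < n) (F (Posz l) + F (Negz l)).

Definition fin_supp F := exists n : nat, forall l, (n <= `|l|)%N -> F l = 0.

(** The eventual value of the partial sums, with 0 as default when they do not stabilise. *)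
Definition int_sum F : V :=
  xget 0 [set v | exists n, forall n', (n <= n')%N -> int_psum F n' = v].

Lemma int_sumE F n v : (forall n', (n <= n')%N -> int_psum F n' = v) ->
  int_sum F = v.
Proof.
move=> Fv; apply: xget_unique; first by exists n.
move=> w [n' Fw]; rewrite -(Fw (maxn n n')) ?leq_maxr //.
by rewrite Fv ?leq_maxl.
Qed.

Lemma int_psum_supp F n : (forall l, (n <= `|l|)%N -> F l = 0) ->
  forall n', (n <= n')%N -> int_psum F n' = int_psum F n.
Proof.
move=> F0; elim=> [|n' IH]; first by rewrite leqn0 => /eqP ->.
rewrite leq_eqVlt => /orP[/eqP -> //|]; rewrite ltnS => le_nn'.
rewrite /int_psum big_ord_recr /= !F0 ?addr0; [exact: IH|lia|lia].
Qed.

Lemma int_sum_eventually F : fin_supp F ->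
  exists n, forall n', (n <= n')%N -> int_psum F n' = int_sum F.
Proof.
case=> n F0; exists n => n' le_nn'.
rewrite (int_sumE (n := n) (v := int_psum F n)); last exact: int_psum_supp.
exact: int_psum_supp.
Qed.

Lemma int_sumD F G : fin_supp F -> fin_supp G ->
  int_sum (fun l => F l + G l) = int_sum F + int_sum G.
Proof.
move=> /int_sum_eventually[a Fa] /int_sum_eventually[b Gb].
apply: (int_sumE (n := maxn a b)) => n' /[!geq_max] /andP[an bn].
by rewrite -(Fa n') // -(Gb n') // -big_split; apply: eq_bigr => l _; rewrite addrACA.
Qed.

Lemma int_sum0 : int_sum (fun=> 0) = 0.
Proof.
by apply: (int_sumE (n := 0)) => n _; apply: big1 => l _; rewrite addr0.
Qed.

Lemma int_sum1 F n : (forall l, l != n -> F l = 0) -> int_sum F = F n.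
Proof.
move=> F0; apply: (int_sumE (n := `|n|.+1)) => n' n_lt.
case: n F0 n_lt => a F0 a_lt.
  rewrite /int_psum (bigD1 (Ordinal (a_lt : (a < n')%N))) //= big1 ?addr0.
    by rewrite (F0 (Negz a)) ?addr0.
  move=> l /eqP l_neq; rewrite !F0 ?addr0 //.
  by apply/eqP => -[la]; apply: l_neq; apply: val_inj.
rewrite /int_psum (bigD1 (Ordinal (ltnW a_lt : (a < n')%N))) //= big1 ?addr0.
  by rewrite (F0 (Posz a)) ?add0r.
move=> l /eqP l_neq; rewrite !F0 ?addr0 //.
by apply/eqP => -[la]; apply: l_neq; apply: val_inj.
Qed.

End IntSum.

(** * Laurent expansions at a rational point *)

Section Coefficients.
Variables (K L : fieldType) (j : {rmorphism K -> L}) (p : set L) (z : L).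
Hypotheses (p_rational : rational_point j p) (z_parameter : local_parameter p z).

Let z_neq0 : z != 0. Proof. by case: z_parameter. Qed.

Lemma point1 : p 1. Proof. by case: p_rational => -[[]]. Qed.

Lemma pointB x y : p x -> p y -> p (x - y).
Proof. by case: p_rational => -[[_ + _] _ _] _; apply. Qed.

Lemma pointM x y : p x -> p y -> p (x * y).
Proof. by case: p_rational => -[[_ _ +] _ _] _; apply. Qed.

Lemma point0 : p 0. Proof. by rewrite -(subrr 1); apply: pointB; exact: point1. Qed.

Lemma pointD x y : p x -> p y -> p (x + y).
Proof.
by move=> px py; rewrite -[y]opprK; apply: pointB => //; rewrite -sub0r; apply: pointB => //; exact: point0.
Qed.

Lemma point_const a : p (j a). Proof. by case: p_rational => -[]. Qed.

Lemma pointz : p z. Proof. by case: z_parameter => -[]. Qed.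

(** Order at [p] at least [n], stated without a valuation, so that 0 has every order. *)
Definition ord_ge (n : int) : set L := [set x | p (x * z ^ (- n))].

Lemma ord_ge0 x : ord_ge 0 x = p x :> Prop.
Proof. by rewrite /ord_ge /= oppr0 expr0z mulr1. Qed.

Lemma ord_geD n x y : ord_ge n x -> ord_ge n y -> ord_ge n (x + y).
Proof. by rewrite /ord_ge /= mulrDl; apply: pointD. Qed.

Lemma ord_geB n x y : ord_ge n x -> ord_ge n y -> ord_ge n (x - y).
Proof. by rewrite /ord_ge /= mulrBl; apply: pointB. Qed.

Lemma ord_geM a b x y : ord_ge a x -> ord_ge b y -> ord_ge (a + b) (x * y).
Proof. by rewrite /ord_ge /= opprD expfzDr // mulrACA; apply: pointM. Qed.

Lemma ord_geMp a x y : p x -> ord_ge a y -> ord_ge a (x * y).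
Proof. by rewrite -ord_ge0 -{2}[a]add0r; apply: ord_geM. Qed.

Lemma ord_ge_zero n : ord_ge n 0.
Proof. by rewrite /ord_ge /= mul0r; exact: point0. Qed.

Lemma point_expz n : 0 <= n -> p (z ^ n).
Proof.
case: n => n // _; elim: n => [|n IH]; first exact: point1.
by rewrite exprSz; apply: pointM => //; exact: pointz.
Qed.

Lemma ord_ge_mono a b x : b <= a -> ord_ge a x -> ord_ge b x.
Proof.
move=> ba; rewrite /ord_ge /= => px.
have -> : x * z ^ (- b) = x * z ^ (- a) * z ^ (a - b).
  by rewrite -mulrA -expfzDr //; congr (_ * _ ^ _); lia.
by apply: pointM => //; apply: point_expz; lia.
Qed.

Lemma ord_ge_expz a : ord_ge a (z ^ a).
Proof. by rewrite /ord_ge /= -expfzDr // subrr expr0z; exact: point1. Qed.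

Lemma ord_ge_monomial a b n : b <= n -> ord_ge b (j a * z ^ n).
Proof.
move=> bn; apply: ord_geMp (point_const a) _.
exact: ord_ge_mono bn (ord_ge_expz n).
Qed.

Lemma ord_ge_sum n I (s : seq I) (P : pred I) (F : I -> L) :
  (forall l, P l -> ord_ge n (F l)) -> ord_ge n (\sum_(l <- s | P l) F l).
Proof. by move=> Fn; elim/big_ind: _ => //; [exact: ord_ge_zero|exact: ord_geD]. Qed.

(** If x = u z^n with n <= 0, then z^(-n) u^-1 would be an inverse of x in the local ring. *)
Lemma max_ideal_ord x : max_ideal p x -> ord_ge 1 x.
Proof.
case=> px x_nonunit; have [->|x_neq0] := eqVneq x 0; first exact: ord_ge_zero.
case: z_parameter => _ _ /(_ x x_neq0)[n [u [pu [u' pu' uu']] x_def]].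
have n_gt0 : 1 <= n.
  rewrite leNgt; apply/negP => n_lt1; apply: x_nonunit; split=> //.
  exists (z ^ (- n) * u'); first by apply: pointM => //; apply: point_expz; lia.
  by rewrite x_def mulrA -[u * _ * _]mulrA -expfzDr // subrr expr0z mulr1.
rewrite x_def; apply: ord_geMp pu _; apply: ord_ge_mono n_gt0 _; exact: ord_ge_expz.
Qed.

Lemma const_ord_eq0 a : ord_ge 1 (j a) -> a = 0.
Proof.
move=> ja; apply: contrapT => /eqP a_neq0.
case: z_parameter => -[_ +] _ _; apply; split; first exact: pointz.
(* This is the element 1/z, so a nonzero constant of order at least 1 would make [z] a unit. *)
exists (j a * z ^ (-1) * j a^-1).
  by apply: pointM (point_const _).
by rewrite (_ : z ^ (-1) = z^-1) // fmorphV; field; rewrite fmorph_eq0 a_neq0 z_neq0.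
Qed.

Lemma residue_exists x : p x -> exists a, ord_ge 1 (x - j a).
Proof. by case: p_rational => _ res /res[a /max_ideal_ord]; exists a. Qed.

Lemma ord_ge_exists x : exists n : nat, ord_ge (- n%:Z) x.
Proof.
have [->|x_neq0] := eqVneq x 0; first by exists 0%N; exact: ord_ge_zero.
case: z_parameter => _ _ /(_ x x_neq0)[n [u [pu _] ->]]; exists `|n|%N.
by apply: ord_geMp pu _; apply: ord_ge_mono (ord_ge_expz n); lia.
Qed.

(** A polynomial in 1/z: a principal part together with its constant term. *)
Definition polar (q : {poly K}) : L := (map_poly j q).[z^-1].

Lemma polarE q : polar q = \sum_(l < size q) j q`_l * z ^ (- l%:Z).
Proof.
rewrite /polar horner_coef size_map_poly; apply: eq_bigr => l _.
by rewrite coef_map exprVn -exprnN.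
Qed.

Lemma polarD q q' : polar (q + q') = polar q + polar q'.
Proof. by rewrite /polar rmorphD hornerD. Qed.

Lemma polarB q q' : polar (q - q') = polar q - polar q'.
Proof. by rewrite /polar rmorphB hornerD hornerN. Qed.

Lemma polar_monomial a n : polar (a *: 'X^n) = j a * z ^ (- n%:Z).
Proof. by rewrite /polar map_polyZ map_polyXn hornerZ hornerXn exprVn -exprnN. Qed.

Lemma polar_exists x : exists q, ord_ge 1 (x - polar q).
Proof.
(* Induction on the pole order. For n = 0 the order is at least 1 and q = 0 serves; an element of
   order at least -n loses its z^-n term, whose coefficient is the residue of x z^n. *)
suff [n xn] : exists n : nat, ord_ge (1 - n%:Z) x.
  elim: n x xn => [|n IH] x xn; first by exists 0; rewrite /polar rmorph0 horner0 subr0.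
  have /residue_exists[a xa] : p (x * z ^ n%:Z).
    by move: xn; rewrite /ord_ge /=; congr (p (_ * _ ^ _)); lia.
  case: (IH (x - j a * z ^ (- n%:Z))).
    have := ord_geM xa (ord_ge_expz (- n%:Z)).
    by rewrite mulrBl -mulrA -expfzDr // subrr expr0z mulr1.
  move=> q; rewrite -addrA -opprD => qx; exists (a *: 'X^n + q).
  by rewrite polarD polar_monomial.
by have [n xn] := ord_ge_exists x; exists n.+1; congr (ord_ge _ _): xn; lia.
Qed.

(** For q of degree n the terms below the top one have order at least 1 - n, so the top coefficient
    would have positive order and vanish. This makes principal parts unique. *)
Lemma polar_eq0 q : ord_ge 1 (polar q) -> q = 0.
Proof.
move=> pq; apply: contrapT => /eqP q_neq0.
have sq : size q = (size q).-1.+1 by rewrite prednK // lt0n size_poly_eq0.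
suff : j (lead_coef q) = 0.
  by move/eqP; rewrite fmorph_eq0 lead_coef_eq0 (negPf q_neq0).
rewrite [lead_coef q]const_ord_eq0 ?rmorph0 //.
set n := (size q).-1 in sq.
have low : ord_ge (1 - n%:Z) (j (lead_coef q) * z ^ (- n%:Z)).
  have -> : j (lead_coef q) * z ^ (- n%:Z) =
      polar q - \sum_(l < n) j q`_l * z ^ (- l%:Z).
    by rewrite polarE sq big_ord_recr /= addrAC subrr add0r lead_coefE.
  apply: ord_geB; first by apply: ord_ge_mono pq; lia.
  by apply: ord_ge_sum => l _; apply: ord_ge_monomial; have := ltn_ord l; lia.
have := ord_geM low (ord_ge_expz n%:Z).
by rewrite -mulrA -expfzDr // subrK addNr expr0z mulr1.
Qed.

(* The constant coefficient of the Laurent expansion of x in K((z)), read off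
   from the principal part: x = q(1/z) + O(z). *)
Definition const_coef (x : L) : K :=
  xget 0 [set a | exists2 q : {poly K}, ord_ge 1 (x - polar q) & a = q`_0].

Lemma const_coefE x q : ord_ge 1 (x - polar q) -> const_coef x = q`_0.
Proof.
move=> qx; apply: xget_unique; first by exists q.
move=> _ [q' q'x ->]; suff /subr0_eq -> : q' - q = 0 by [].
apply: polar_eq0; rewrite polarB.
have -> : polar q' - polar q = (x - polar q) - (x - polar q') by ring.
exact: ord_geB.
Qed.

Lemma const_coefB : {morph const_coef : x y / x - y}.
Proof.
move=> x y; have [q qx] := polar_exists x; have [q' qy] := polar_exists y.
rewrite (const_coefE qx) (const_coefE qy) -coefB; apply: const_coefE.
have -> : x - y - polar (q - q') = (x - polar q) - (y - polar q').
  by rewrite polarB; ring.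
exact: ord_geB.
Qed.

HB.instance Definition _ := GRing.isZmodMorphism.Build L K const_coef const_coefB.

Lemma const_coef_ord n x : 0 < n -> ord_ge n x -> const_coef x = 0.
Proof.
move=> n_gt0 xn; rewrite (const_coefE (q := 0)) ?coef0 //.
by rewrite /polar rmorph0 horner0 subr0; apply: ord_ge_mono xn; lia.
Qed.

Lemma const_coef_monomial a n : const_coef (j a * z ^ n) = if n == 0 then a else 0.
Proof.
case: (ltrP 0 n) => [n_gt0|n_le0].
  by rewrite (const_coef_ord n_gt0) ?gt_eqF //; exact: ord_ge_monomial.
rewrite (const_coefE (q := a *: 'X^`|n|)) ?coefZ ?coefXn.
  have -> : (0%N == `|n|%N) = (n == 0) by lia.
  by case: eqP => _; rewrite ?mulr1 ?mulr0.
rewrite polar_monomial; have -> : - `|n|%N%:Z = n by lia.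
rewrite subrr; exact: ord_ge_zero.
Qed.

(** Stands in for the density of Laurent polynomials: the principal part of x z^(1 - n), multiplied
    back by z^(n - 1), is a finite sum of monomials and differs from x by order at least n. *)
Lemma laurent_ind (P : L -> Prop) (n : int) :
    (forall x y, P x -> P y -> P (x + y)) ->
    (forall a b, P (j a * z ^ b)) -> (forall x, ord_ge n x -> P x) ->
  forall x, P x.
Proof.
move=> PD Pmon Pord x; have [q qx] := polar_exists (x * z ^ (1 - n)).
have -> : x = (x - polar q * z ^ (n - 1)) + polar q * z ^ (n - 1).
  by rewrite subrK.
apply: (PD).
  apply: (Pord); have := ord_geM qx (ord_ge_expz (n - 1)).
  have -> : 1 + (n - 1) = n by lia.
  by rewrite mulrBl -mulrA -expfzDr // (_ : 1 - n + (n - 1) = 0) ?expr0z ?mulr1 //; lia.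
rewrite polarE mulr_suml; apply: (big_ind P) => [||l _].
- by apply: Pord; exact: ord_ge_zero.
- exact: PD.
by rewrite -mulrA -expfzDr.
Qed.

End Coefficients.

(** * Differentials and modules of additive maps *)

Section KaehlerGeneration.
Variables (k F : fieldType) (i : k -> F) (Om : kaehler i).

Lemma kd0 a : kd Om (i a) = 0. Proof. by case: (kd_derivation Om). Qed.

Lemma kdD x y : kd Om (x + y) = kd Om x + kd Om y.
Proof. by case: (kd_derivation Om). Qed.

Lemma kdM x y : kd Om (x * y) = x *: kd Om y + y *: kd Om x.
Proof. by case: (kd_derivation Om). Qed.

Lemma kd1 : kd Om 1 = 0.
Proof.
have := kdM 1 1; rewrite mulr1 !scale1r => /eqP.
by rewrite -subr_eq subrr eq_sym => /eqP.
Qed.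

Lemma kd_exprz x (n : int) : x != 0 -> kd Om (x ^ n) = (n%:~R * x ^ (n - 1)) *: kd Om x.
Proof.
move=> x0; have pos (e : nat) : kd Om (x ^ e%:Z) = (e%:R * x ^ (e%:Z - 1)) *: kd Om x.
  elim: e => [|e IH]; first by rewrite expr0z mul0r scale0r kd1.
  rewrite exprSz kdM {}IH scalerA -scalerDl; congr (_ *: _).
  rewrite mulrCA -{1}(expr1z x) -expfzDr // (_ : 1 + (e%:Z - 1) = e); last by lia.
  by rewrite (_ : e.+1%:Z - 1 = e) -?natr1 ?mulrDl ?mul1r //; lia.
case: n => e; first exact: pos.
(* Negative exponents: differentiate x^(-a) x^a = 1. *)
rewrite NegzE; set a : int := e.+1%:Z; have := kdM (x ^ (- a)) (x ^ a).
rewrite -expfzDr // addNr expr0z kd1 pos => /esym/eqP; rewrite addr_eq0 => /eqP H.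
have xa0 : x ^ a != 0 by rewrite expfz_neq0.
apply: (scalerI xa0); rewrite -[LHS]opprK -H scalerA -scaleNr scalerA; congr (_ *: _).
rewrite mulrNz mulNr mulrN; congr (- _); rewrite mulrCA [RHS]mulrCA -!expfzDr //.
by congr (_ * _ ^ _); lia.
Qed.

Section Submodule.
Variable P : Om -> Prop.
Hypotheses (P0 : P 0) (Plin : forall a u v, P u -> P v -> P (a *: u + v)).
Hypothesis Pd : forall x, P (kd Om x).

Let S : pred Om := fun w => `[< P w >].

Let S_closed : submod_closed S.
Proof.
split=> [|a u v]; first exact/asboolP.
by move=> /asboolP Pu /asboolP Pv; apply/asboolP; exact: Plin.
Qed.

HB.instance Definition _ := GRing.isSubmodClosed.Build F Om S S_closed.
HB.instance Definition _ :=
  [SubChoice_isSubLmodule of {w : Om | S w} by <:].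

(* By uniqueness in the universal property, Om -> S -> Om is the identity. *)
Lemma kaehler_ind w : P w.
Proof.
pose d x : {w : Om | S w} := exist _ (kd Om x) (asboolT (Pd x)).
have d_der : derivation i d.
  by split=> [a|x y|x y]; apply: val_inj; rewrite /= ?kd0 ?kdD ?kdM.
have [f [fd _]] := kd_universal Om d_der.
have [g [_ g_uniq]] := kd_universal Om (kd_derivation Om).
pose h : {linear Om -> Om} := (val : {w | S w} -> Om) \o f.
have hw : h w = w.
  rewrite (g_uniq h) => [|x]; last by rewrite /= fd.
  by rewrite -(g_uniq idfun).
by rewrite -hw; apply/asboolP; exact: (valP (f w)).
Qed.
End Submodule.

End KaehlerGeneration.

(* A Laurent series w over V is encoded by the additive map h |-> Res (h w) on L;
   multiplication of w by a then becomes precomposition with multiplication by a,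
   and no convolution product is needed. *)
Section AdditiveMaps.
Variables (R : comPzRingType) (V : zmodType).

Record addmap := AddMap { addmap_fun :> R -> V; addmapB : zmod_morphism addmap_fun }.

HB.instance Definition _ := gen_eqMixin addmap.
HB.instance Definition _ := gen_choiceMixin addmap.

HB.instance Definition _ (f : addmap) :=
  GRing.isZmodMorphism.Build R V (addmap_fun f) (addmapB f).

Lemma addmapP (f g : addmap) : f =1 g -> f = g.
Proof.
case: f g => f fB [g gB] /= /funext fg; case: _ / fg in gB *.
by congr AddMap; exact: Prop_irrelevance.
Qed.

Lemma addmap0_subproof : zmod_morphism (fun _ : R => 0 : V).
Proof. by move=> x y; rewrite subrr. Qed.
Lemma addmapN_subproof (f : addmap) : zmod_morphism (fun x : R => - f x).
Proof. by move=> x y; rewrite raddfB opprD. Qed.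
Lemma addmapD_subproof (f g : addmap) : zmod_morphism (fun x : R => f x + g x).
Proof. by move=> x y; rewrite !raddfB opprD addrACA. Qed.

Definition addmap0 := AddMap addmap0_subproof.
Definition addmapN f := AddMap (addmapN_subproof f).
Definition addmapD f g := AddMap (addmapD_subproof f g).

Lemma addmapZ_subproof a (f : addmap) : zmod_morphism (fun x : R => f (x * a)).
Proof. by move=> x y; rewrite mulrBl raddfB. Qed.
Definition addmapZ a f := AddMap (addmapZ_subproof a f).

Lemma addmapDA : associative addmapD.
Proof. by move=> f g h; apply: addmapP => x /=; rewrite addrA. Qed.
Lemma addmapDC : commutative addmapD.
Proof. by move=> f g; apply: addmapP => x /=; rewrite addrC. Qed.
Lemma addmap0D : left_id addmap0 addmapD.
Proof. by move=> f; apply: addmapP => x /=; rewrite add0r. Qed.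
Lemma addmapND : left_inverse addmap0 addmapN addmapD.
Proof. by move=> f; apply: addmapP => x /=; rewrite addNr. Qed.

HB.instance Definition _ :=
  GRing.isZmodule.Build addmap addmapDA addmapDC addmap0D addmapND.

Lemma addmapZA a b f : addmapZ a (addmapZ b f) = addmapZ (a * b) f.
Proof. by apply: addmapP => x /=; rewrite mulrA. Qed.
Lemma addmap1Z : left_id 1 addmapZ.
Proof. by move=> f; apply: addmapP => x /=; rewrite mulr1. Qed.
Lemma addmapZDr : right_distributive addmapZ +%R.
Proof. by move=> a f g; apply: addmapP. Qed.
Lemma addmapZDl f : {morph addmapZ^~ f : a b / a + b}.
Proof. by move=> a b; apply: addmapP => x /=; rewrite mulrDr raddfD. Qed.

HB.instance Definition _ :=
  GRing.Zmodule_isLmodule.Build R addmap addmapZA addmap1Z addmapZDr addmapZDl.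

Lemma addmapDE (f g : addmap) x : (f + g) x = f x + g x. Proof. by []. Qed.
Lemma addmapNE (f : addmap) x : (- f) x = - f x. Proof. by []. Qed.
Lemma addmapZE a (f : addmap) x : (a *: f) x = f (x * a). Proof. by []. Qed.
Lemma addmap_sumE I (s : seq I) (P : pred I) (f : I -> addmap) x :
  (\sum_(l <- s | P l) f l) x = \sum_(l <- s | P l) f l x.
Proof. by elim/big_rec2: _ => // l y g _ <-. Qed.

End AdditiveMaps.

(** * The residue pairing *)

Section LaurentSums.
Variables (K L : fieldType) (j : {rmorphism K -> L}) (p : set L) (z : L).
Hypotheses (p_rational : rational_point j p) (z_parameter : local_parameter p z).

Let z_neq0 : z != 0. Proof. by case: z_parameter. Qed.

Local Notation ord_ge := (ord_ge p z).
Local Notation const_coef := (const_coef j p z).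

Lemma const_coefD x y : const_coef (x + y) = const_coef x + const_coef y.
Proof.
have B := const_coefB p_rational z_parameter.
have c0 : const_coef 0 = 0 by rewrite -(subrr 0) B subrr.
by rewrite -{1}[y]opprK B -(sub0r y) B c0 sub0r opprK.
Qed.

(** The cutoff in one argument depends on the order of the other: [x] is truncated first, against
    the pole order of [y], then [y] against each monomial in [x]. *)
Lemma laurent_ind2 (P : L -> L -> Prop) (n : int) :
    (forall x y w, P x w -> P y w -> P (x + y) w) ->
    (forall x y w, P x y -> P x w -> P x (y + w)) ->
    (forall a b a' b', P (j a * z ^ b) (j a' * z ^ b')) ->
    (forall a b x y, n < a + b -> ord_ge a x -> ord_ge b y -> P x y) ->
  forall x y, P x y.
Proof.
move=> PDl PDr Pmon Pord x y.
have [n' yn'] := ord_ge_exists p_rational z_parameter y.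
apply: (laurent_ind p_rational z_parameter (n := n + n'%:Z + 1)
    (P := P^~ y)) => [*|a b|x' ox'].
- exact: PDl.
- apply: (laurent_ind p_rational z_parameter (n := n - b + 1)
      (P := P _)) => [*|//|y' oy'].
    exact: PDr.
  apply: Pord (ord_ge_monomial p_rational z_parameter a (lexx b)) oy'; lia.
- by apply: Pord ox' yn'; lia.
Qed.

Definition laurent_coef (n : int) (x : L) : K := const_coef (x * z ^ (- n)).

Lemma laurent_coefD n x y : laurent_coef n (x + y) = laurent_coef n x + laurent_coef n y.
Proof. by rewrite /laurent_coef mulrDl const_coefD. Qed.

Lemma laurent_coef_ord n l x : ord_ge n x -> l < n -> laurent_coef l x = 0.
Proof.
move=> xn ln; have := ord_geM p_rational z_parameter xn (ord_ge_expz p_rational z_parameter (- l)).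
by apply: const_coef_ord => //; lia.
Qed.

Lemma laurent_coef_monomial l a n : laurent_coef l (j a * z ^ n) = if n == l then a else 0.
Proof.
by rewrite /laurent_coef -mulrA -expfzDr // const_coef_monomial // subr_eq0.
Qed.

Lemma laurent_coef_mul_expz l x n : laurent_coef l (x * z ^ n) = laurent_coef (l - n) x.
Proof. by rewrite /laurent_coef -mulrA -expfzDr //; congr (const_coef (_ * _ ^ _)); lia. Qed.

Lemma laurent_coefZ l a x : laurent_coef l (j a * x) = a * laurent_coef l x.
Proof.
apply: (laurent_ind p_rational z_parameter (n := l + 1)
  (P := fun x => laurent_coef l (j a * x) = a * laurent_coef l x)) x => [x y xE yE|b n|x xl].
- by rewrite mulrDr !laurent_coefD xE yE mulrDr.
- by rewrite mulrA -rmorphM !laurent_coef_monomial; case: eqP; rewrite ?mulr0.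
rewrite !(laurent_coef_ord (n := l + 1)) ?mulr0 //; try lia.
exact: (ord_geMp p_rational z_parameter (point_const p_rational a)) xl.
Qed.

(** * Coefficientwise operators on Laurent series *)

Section Operator.
Variable V : zmodType.
Implicit Type beta : int -> K -> V.

(** Laurent coefficients vanish far to the left and a tame family far to the right, so the sum of
    all [beta l] applied to the l-th coefficient is finite. *)
Definition tame beta := (forall l, zmod_morphism (beta l)) /\
  exists n : int, forall l a, n <= l -> beta l a = 0.

Definition laurent_sum beta (f : L) := int_sum (fun l => beta l (laurent_coef l f)).

Lemma tame0 beta l : tame beta -> beta l 0 = 0.
Proof. by case=> betaB _; have := betaB l 0 0; rewrite !subrr. Qed.

Lemma tameD beta l a b : tame beta -> beta l (a + b) = beta l a + beta l b.
Proof.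
move=> tb; have [betaB _] := tb.
by rewrite -{1}[b]opprK betaB -(sub0r b) betaB tame0 // sub0r opprK.
Qed.

Lemma tame_fin_supp beta f : tame beta -> fin_supp (fun l => beta l (laurent_coef l f)).
Proof.
move=> tb; have [_ [n beta0]] := tb.
have [n' fn'] := ord_ge_exists p_rational z_parameter f.
exists (`|n| + n').+1 => l nl.
have [?|?] := lerP n l; first by rewrite beta0.
by rewrite (laurent_coef_ord fn') ?tame0 //; lia.
Qed.

Lemma laurent_sumD beta f f' : tame beta ->
  laurent_sum beta (f + f') = laurent_sum beta f + laurent_sum beta f'.
Proof.
move=> tb; rewrite /laurent_sum -int_sumD; try exact: tame_fin_supp.
by congr int_sum; apply: funext => l; rewrite laurent_coefD tameD.
Qed.

Lemma laurent_sumDl beta beta' f : tame beta -> tame beta' ->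
  laurent_sum (fun l a => beta l a + beta' l a) f =
  laurent_sum beta f + laurent_sum beta' f.
Proof. by move=> tb tb'; rewrite /laurent_sum -int_sumD //; exact: tame_fin_supp. Qed.

Lemma laurent_sum_monomial beta a n : tame beta ->
  laurent_sum beta (j a * z ^ n) = beta n a.
Proof.
move=> tb; rewrite /laurent_sum (int_sum1 (n := n)); first by rewrite laurent_coef_monomial eqxx.
by move=> l ln; rewrite laurent_coef_monomial eq_sym (negPf ln) tame0.
Qed.

Lemma laurent_sum_eq0 beta f :
  (forall l, beta l (laurent_coef l f) = 0) -> laurent_sum beta f = 0.
Proof.
by move=> b0; rewrite -[RHS](int_sum0 V); congr int_sum; apply: funext.
Qed.
End Operator.

Variables (k : fieldType) (i : {rmorphism k -> K}) (OmK : kaehler i).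

(* The constant term of h times the coefficientwise differential of f. *)
Definition pairing (h f : L) : OmK :=
  laurent_sum (fun l a => laurent_coef (- l) h *: kd OmK a) f.

Lemma pairing_tame h : tame (fun l a => laurent_coef (- l) h *: kd OmK a).
Proof.
split=> [l a b|].
  have kdB : kd OmK (a - b) = kd OmK a - kd OmK b.
    by apply: (addIr (kd OmK b)); rewrite -kdD !subrK.
  by rewrite kdB scalerBr.
have [n hn] := ord_ge_exists p_rational z_parameter h.
by exists (n.+1%:Z) => l a nl; rewrite (laurent_coef_ord hn) ?scale0r //; lia.
Qed.

Lemma pairingDl h h' f : pairing (h + h') f = pairing h f + pairing h' f.
Proof.
rewrite -laurent_sumDl; try exact: pairing_tame.
by congr laurent_sum; apply: funext => l; apply: funext => a; rewrite laurent_coefD scalerDl.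
Qed.

Lemma pairingDr h f f' : pairing h (f + f') = pairing h f + pairing h f'.
Proof. exact/laurent_sumD/pairing_tame. Qed.

Lemma pairing_monomial h a n : pairing h (j a * z ^ n) = laurent_coef (- n) h *: kd OmK a.
Proof. by rewrite /pairing laurent_sum_monomial //; exact: pairing_tame. Qed.

Lemma pairing_ord a b h f : ord_ge a h -> ord_ge b f -> 0 < a + b -> pairing h f = 0.
Proof.
move=> ha fb ab; apply: laurent_sum_eq0 => l; have [lb|?] := ltrP l b.
  by rewrite (laurent_coef_ord fb) // (tame0 _ (pairing_tame h)).
by rewrite (laurent_coef_ord ha) ?scale0r //; lia.
Qed.

Lemma pairingZl a h f : pairing (j a * h) f = a *: pairing h f.
Proof.
have [n hn] := ord_ge_exists p_rational z_parameter h.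
apply: (laurent_ind p_rational z_parameter (n := n%:Z + 1)
  (P := fun f => pairing (j a * h) f = a *: pairing h f)) f => [x y xE yE|b m|x xn].
- by rewrite !pairingDr xE yE scalerDr.
- by rewrite !pairing_monomial laurent_coefZ scalerA.
rewrite !(pairing_ord (a := - n%:Z) (b := n%:Z + 1)) ?scaler0 //; try lia.
exact: (ord_geMp p_rational z_parameter (point_const p_rational a)) hn.
Qed.

(** On monomials this is the Leibniz rule in [K]; all three terms vanish once the orders of [f] and
    [f'] together exceed the pole order of [h]. *)
Lemma pairingM h f f' : pairing h (f * f') = pairing (h * f) f' + pairing (h * f') f.
Proof.
have [n hn] := ord_ge_exists p_rational z_parameter h.
apply: (laurent_ind2 (n := n)
  (P := fun f f' => pairing h (f * f') = pairing (h * f) f' + pairing (h * f') f)) f f'.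
- move=> x y w; rewrite mulrDl mulrDr !pairingDr pairingDl => -> ->.
  by rewrite addrACA.
- move=> x y w; rewrite !mulrDr !pairingDr pairingDl => -> ->.
  by rewrite addrACA.
- move=> a b a' b'; rewrite mulrACA -rmorphM -expfzDr // !pairing_monomial.
  rewrite ![h * (_ * _)]mulrA !laurent_coef_mul_expz ![h * _]mulrC !laurent_coefZ kdM.
  rewrite scalerDr !scalerA ![laurent_coef _ _ * _]mulrC.
  by congr (_ * laurent_coef _ _ *: _ + _ * laurent_coef _ _ *: _); lia.
move=> a b x y n_lt ax b_y.
have M := ord_geM p_rational z_parameter.
rewrite (pairing_ord hn (M _ _ _ _ ax b_y)); last lia.
rewrite (pairing_ord (M _ _ _ _ hn ax) b_y); last lia.
by rewrite (pairing_ord (M _ _ _ _ hn b_y) ax) ?addr0 //; lia.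
Qed.

(* The constant term of h * (z dg/dz) * df, the latter differential being taken
   coefficientwise; equivalently, the residue of h dg /\ df. *)
Definition res (h g f : L) : OmK :=
  laurent_sum (fun l a => (l%:~R * a) *: pairing (h * z ^ l) f) g.

Lemma res_tame h f : tame (fun l a => (l%:~R * a) *: pairing (h * z ^ l) f).
Proof.
split=> [l a b|]; first by rewrite mulrBr scalerBl.
have [n hn] := ord_ge_exists p_rational z_parameter h.
have [m fm] := ord_ge_exists p_rational z_parameter f.
exists ((n + m).+1%:Z) => l a nml.
have hl := ord_geM p_rational z_parameter hn (ord_ge_expz p_rational z_parameter l).
by rewrite (pairing_ord hl fm) ?scaler0 //; lia.
Qed.

Lemma resDh h h' g f : res (h + h') g f = res h g f + res h' g f.
Proof.
rewrite -laurent_sumDl; try exact: res_tame.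
congr laurent_sum; apply: funext => l; apply: funext => a.
by rewrite mulrDl pairingDl scalerDr.
Qed.

Lemma resDg h g g' f : res h (g + g') f = res h g f + res h g' f.
Proof. exact/laurent_sumD/res_tame. Qed.

Lemma resDf h g f f' : res h g (f + f') = res h g f + res h g f'.
Proof.
rewrite -laurent_sumDl; try exact: res_tame.
congr laurent_sum; apply: funext => l; apply: funext => a.
by rewrite pairingDr scalerDr.
Qed.

Lemma res_monomial h a n f :
  res h (j a * z ^ n) f = (n%:~R * a) *: pairing (h * z ^ n) f.
Proof. by rewrite /res laurent_sum_monomial //; exact: res_tame. Qed.

Lemma res_ord a b c h g f : ord_ge a h -> ord_ge b g -> ord_ge c f ->
  0 < a + b + c -> res h g f = 0.
Proof.
move=> ha gb fc abc; apply: laurent_sum_eq0 => l; have [lb|lb] := ltrP l b.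
  by rewrite (laurent_coef_ord gb) // mulr0 scale0r.
have hl := ord_geM p_rational z_parameter ha (ord_ge_expz p_rational z_parameter l).
by rewrite (pairing_ord hl fc) ?scaler0 //; lia.
Qed.

(** The orders only sum to 0, so [res_ord] does not apply. The one term that could survive has l =
    0, and the factor [l] coming from z d/dz kills it. *)
Lemma res_point h g f : p h -> p g -> p f -> res h g f = 0.
Proof.
have E x : p x -> ord_ge 0 x by rewrite ord_ge0.
move=> /E h0 /E g0 /E f0; apply: laurent_sum_eq0 => l.
have [l0|l0|->] := ltrgtP l 0; last by rewrite mul0r scale0r.
  by rewrite (laurent_coef_ord g0) // mulr0 scale0r.
have hl := ord_geM p_rational z_parameter h0 (ord_ge_expz p_rational z_parameter l).
by rewrite (pairing_ord hl f0) ?scaler0 //; lia.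
Qed.

Lemma resMf h g f f' : res h g (f * f') = res (h * f) g f' + res (h * f') g f.
Proof.
rewrite -laurent_sumDl; try exact: res_tame.
congr laurent_sum; apply: funext => l; apply: funext => a.
by rewrite pairingM scalerDr ![h * z ^ l * _]mulrAC.
Qed.

(** On monomials the exponent b + b' produced by z d/dz splits into the two terms of the Leibniz
    rule. *)
Lemma resMg h g g' f : res h (g * g') f = res (h * g) g' f + res (h * g') g f.
Proof.
have [n hn] := ord_ge_exists p_rational z_parameter h.
have [m fm] := ord_ge_exists p_rational z_parameter f.
apply: (laurent_ind2 (n := n%:Z + m%:Z)
  (P := fun g g' => res h (g * g') f = res (h * g) g' f + res (h * g') g f)) g g'.
- move=> x y w; rewrite mulrDl mulrDr !resDg resDh => -> ->.
  by rewrite addrACA.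
- move=> x y w; rewrite !mulrDr !resDg resDh => -> ->.
  by rewrite addrACA.
- move=> a b a' b'; rewrite mulrACA -rmorphM -expfzDr // !res_monomial.
  have S c e d : h * (j c * z ^ e) * z ^ d = j c * (h * z ^ (e + d)).
    by rewrite expfzDr //; ring.
  rewrite !S !pairingZl !scalerA [b' + b]addrC -scalerDl; congr (_ *: _).
  by rewrite rmorphD /=; ring.
move=> a b x y n_lt ax b_y.
have M := ord_geM p_rational z_parameter.
rewrite (res_ord hn (M _ _ _ _ ax b_y) fm); last lia.
rewrite (res_ord (M _ _ _ _ hn ax) b_y fm); last lia.
by rewrite (res_ord (M _ _ _ _ hn b_y) ax fm) ?addr0 //; lia.
Qed.

Lemma res_const h a f : res h (j a) f = 0.
Proof. by rewrite -[j a]mulr1 -(expr0z z) res_monomial mul0r scale0r. Qed.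

Lemma res_base h g a : res h g (j (i a)) = 0.
Proof.
apply: laurent_sum_eq0 => l; rewrite -[j (i a)]mulr1 -(expr0z z) pairing_monomial.
by rewrite kd0 !scaler0.
Qed.

Lemma res_z_const h a : res h z (j a) = const_coef (h * z) *: kd OmK a.
Proof.
rewrite -{1}[z]mul1r -(rmorph1 j) -{1}(expr1z z) res_monomial mulr1 scale1r.
rewrite -[j a]mulr1 -(expr0z z) pairing_monomial expr1z.
by rewrite /laurent_coef !oppr0 expr0z mulr1.
Qed.

(** The Laurent coefficients of [z] are 0 and 1, whose differentials vanish. *)
Lemma res_z_z h : res h z z = 0.
Proof.
have zE : z = j 1 * z ^ 1 by rewrite rmorph1 mul1r.
apply: laurent_sum_eq0 => l.
by rewrite [X in pairing _ X]zE pairing_monomial kd1 !scaler0.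
Qed.

End LaurentSums.

(** * The residue of 2-forms *)

Section Wedge.
Variables (F : fieldType) (M : lmodType F) (M2 : exterior_square M).
Local Notation "u ^^ v" := (wedge M2 u v) (at level 40).

Lemma wedgeDl u v w : (u + v) ^^ w = u ^^ w + v ^^ w.
Proof.
by have [+ _ _] := wedge_alternating M2 => /(_ 1 u v w); rewrite !scale1r.
Qed.

Lemma wedgeDr u v w : w ^^ (u + v) = w ^^ u + w ^^ v.
Proof.
by have [_ + _] := wedge_alternating M2 => /(_ 1 u v w); rewrite !scale1r.
Qed.

Lemma wedge0l w : 0 ^^ w = 0.
Proof. by apply: (addrI (0 ^^ w)); rewrite -wedgeDl !addr0. Qed.

Lemma wedge0r w : w ^^ 0 = 0.
Proof. by apply: (addrI (w ^^ 0)); rewrite -wedgeDr !addr0. Qed.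

Lemma wedgeZl a u w : (a *: u) ^^ w = a *: (u ^^ w).
Proof.
by have [+ _ _] := wedge_alternating M2 => /(_ a u 0 w); rewrite wedge0l !addr0.
Qed.

Lemma wedgeZr a u w : w ^^ (a *: u) = a *: (w ^^ u).
Proof.
by have [_ + _] := wedge_alternating M2 => /(_ a u 0 w); rewrite wedge0r !addr0.
Qed.

Lemma wedgeC u v : u ^^ v = - (v ^^ u).
Proof.
have [_ _ alt] := wedge_alternating M2; have := alt (u + v).
by rewrite wedgeDl !wedgeDr !alt add0r addr0 => /eqP; rewrite addr_eq0 => /eqP.
Qed.

Lemma wedge_suml I (s : seq I) (P : pred I) (f : I -> M) w :
  (\sum_(l <- s | P l) f l) ^^ w = \sum_(l <- s | P l) f l ^^ w.
Proof.
by elim/big_rec2: _ => [|l y u _ <-]; rewrite ?wedge0l ?wedgeDl.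
Qed.

Lemma wedge_sumr I (s : seq I) (P : pred I) (f : I -> M) w :
  w ^^ (\sum_(l <- s | P l) f l) = \sum_(l <- s | P l) w ^^ f l.
Proof.
by elim/big_rec2: _ => [|l y u _ <-]; rewrite ?wedge0r ?wedgeDr.
Qed.

End Wedge.

(** * Extension of the residue from functions to forms *)

Section ResidueForm.
Variables (k K L : fieldType) (i : {rmorphism k -> K}) (j : {rmorphism K -> L}).
Variables (p : set L) (z : L).
Hypotheses (p_rational : rational_point j p) (z_parameter : local_parameter p z).
Variables (OmK : kaehler i) (OmL : kaehler (j \o i)) (phi : kaehler_map j OmK OmL).
Variables (Om2 : exterior_square OmL) (dR : exterior_derivative Om2).

Let z_neq0 : z != 0. Proof. by case: z_parameter. Qed.

Local Notation ord_ge := (ord_ge p z).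
Local Notation const_coef := (const_coef j p z).
Local Notation res := (@res K L j p z k i OmK).
Local Notation filtration := (@omega_filtration k K L i j OmL p z).
Local Notation resmap := (addmap L OmK).

Lemma res_addmap_subproof g f : zmod_morphism (fun h : L => res h g f).
Proof.
move=> x y; apply: (addIr (res y g f)).
by rewrite -resDh // !subrK.
Qed.

Definition res_addmap g f : resmap := AddMap (res_addmap_subproof g f).

Lemma res_derg f : derivation (j \o i) (res_addmap ^~ f).
Proof.
split=> [a|x y|x y]; apply: addmapP => h /=.
- exact: res_const.
- exact: resDg.
by rewrite resMg // addmapDE addrC.
Qed.

Lemma res_derf g : derivation (j \o i) (res_addmap g).
Proof.
split=> [a|x y|x y]; apply: addmapP => h /=.
- exact: res_base.
- exact: resDf.
by rewrite resMf // addmapDE addrC.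
Qed.

(** The universal property is applied to [g] with [f] fixed; [res_form] then applies it to [f]. *)
Definition res_form1 f : {linear OmL -> resmap} :=
  projT1 (cid (kd_universal OmL (res_derg f))).

Lemma res_form1E f g : res_form1 f (kd OmL g) = res_addmap g f.
Proof. by rewrite /res_form1; case: cid => /= s []. Qed.

(** Each of the three laws is linear in [u], so exact forms suffice. *)
Lemma res_form1_der u : derivation (j \o i) (res_form1 ^~ u).
Proof.
split=> [a|x y|x y]; elim/kaehler_ind: u => [|b u v hu hv|g].
- by rewrite linear0.
- by rewrite linearP /= hu hv scaler0 addr0.
- by rewrite res_form1E; case: (res_derf g).
- by rewrite !linear0 addr0.
- by rewrite !linearP /= hu hv scalerDr addrACA.
- by rewrite !res_form1E; case: (res_derf g).
- by rewrite !linear0 addr0.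
- rewrite !linearP /= hu hv !scalerDr !scalerA addrACA.
  by rewrite [b * x]mulrC [b * y]mulrC.
- by rewrite !res_form1E; case: (res_derf g).
Qed.

Definition res_form u : {linear OmL -> resmap} :=
  projT1 (cid (kd_universal OmL (res_form1_der u))).

Lemma res_form_kdr u f : res_form u (kd OmL f) = res_form1 f u.
Proof. by rewrite /res_form; case: cid => /= s []. Qed.

Lemma res_formE g f : res_form (kd OmL g) (kd OmL f) = res_addmap g f.
Proof. by rewrite res_form_kdr res_form1E. Qed.

(** The construction gives linearity in the second argument only; linearity in the first comes from
    that of [res_form1] when [w] is exact. *)
Lemma res_formP a u v w : res_form (a *: u + v) w = a *: res_form u w + res_form v w.
Proof.
elim/kaehler_ind: w => [|b w w' hw hw'|g]; first by rewrite !linear0 addr0.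
  rewrite ![res_form _ (b *: _ + _)]linearP hw hw' !scalerDr !scalerA addrACA.
  by rewrite [b * a]mulrC.
by rewrite !res_form_kdr linearP.
Qed.

Lemma res_formDl u v w : res_form (u + v) w = res_form u w + res_form v w.
Proof. by have := res_formP 1 u v w; rewrite !scale1r. Qed.

Lemma res_form0l w : res_form 0 w = 0.
Proof. by apply: (addrI (res_form 0 w)); rewrite -res_formDl !addr0. Qed.

Lemma res_formZl a u w : res_form (a *: u) w = a *: res_form u w.
Proof. by have := res_formP a u 0 w; rewrite res_form0l !addr0. Qed.

Lemma res_form_suml I (s : seq I) (P : pred I) (f : I -> OmL) w :
  res_form (\sum_(l <- s | P l) f l) w = \sum_(l <- s | P l) res_form (f l) w.
Proof.
by elim/big_rec2: _ => [|l y u _ <-]; rewrite ?res_form0l ?res_formDl.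
Qed.

Lemma kmapP a u v : phi (a *: u + v) = j a *: phi u + phi v.
Proof. by rewrite raddfD kmapZ. Qed.

(** The first slot is differentiated along [z], where forms from [K] have no component. *)
Lemma res_form_phil w v : res_form (phi w) v = 0.
Proof.
elim/kaehler_ind: w => [|b w w' hw hw'|g]; first by rewrite raddf0 res_form0l.
  by rewrite kmapP res_formP hw hw' scaler0 addr0.
rewrite kmap_d; elim/kaehler_ind: v => [|b w w' hw hw'|f]; first by rewrite linear0.
  by rewrite linearP /= hw hw' scaler0 addr0.
by rewrite res_formE; apply: addmapP => h; exact: res_const.
Qed.

(** The scalar is the residue of h dz; this is how coefficients over [K] are read off. *)
Lemma res_form_z_phi w h : res_form (kd OmL z) (phi w) h = const_coef (h * z) *: w.
Proof.
elim/kaehler_ind: w h => [|b w w' hw hw'|g] h.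
- by rewrite !raddf0.
- rewrite kmapP [res_form _ _]linearP /= hw hw' scalerDr scalerA; congr (_ *: _ + _).
  rewrite mulrAC mulrC.
  have := laurent_coefZ p_rational z_parameter 0 b (h * z).
  by rewrite /laurent_coef oppr0 expr0z !mulr1 => ->; rewrite mulrC.
by rewrite kmap_d res_formE; exact: res_z_const.
Qed.

Lemma res_form_zz : res_form (kd OmL z) (kd OmL z) = 0.
Proof. by rewrite res_formE; apply: addmapP => h; exact: res_z_z. Qed.

(** [res_form] sees only the dz-component of its first argument and the base component of its
    second; antisymmetrising gives the full dz-part of a wedge product. *)
Definition res_alt u v : resmap := res_form u v - res_form v u.

Lemma res_alt_alternating : alternating_bilinear res_alt.
Proof.
split=> [a u v w|a u v w|u]; last by rewrite /res_alt subrr.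
  by rewrite /res_alt res_formP linearP scalerBr opprD addrACA.
by rewrite /res_alt res_formP linearP scalerBr opprD addrACA.
Qed.

Definition res2 : {linear Om2 -> resmap} :=
  projT1 (cid (wedge_universal Om2 res_alt_alternating)).

Lemma res2E u v : res2 (wedge Om2 u v) = res_form u v - res_form v u.
Proof. by rewrite /res2; case: cid => /= s []. Qed.

Lemma res2_base w : base_2forms phi w -> res2 w = 0.
Proof.
case=> n [c [u [v ->]]]; rewrite raddf_sum big1 //= => l _.
by rewrite linearZ /= res2E !res_form_phil subrr scaler0.
Qed.

(** Once all powers of [z] are moved onto [h], every function involved is regular and [res_point]
    applies. *)
Lemma res_form_filtration a b u v h : filtration a u ->
  filtration b v -> ord_ge (- (a + b)) h -> res_form u v h = 0.
Proof.
move=> [_ [n [f [g [pf pg ->]]]] ->] [_ [n' [f' [g' [pf' pg' ->]]]] ->] hab.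
rewrite res_formZl [res_form _ _]linearZ /= -mulrA -expfzDr // res_form_suml addmap_sumE.
apply: big1 => l _; rewrite raddf_sum addmap_sumE; apply: big1 => l' _ /=.
rewrite res_formZl [res_form _ _]linearZ /= res_formE /=; apply: res_point => //.
have M := pointM p_rational; apply: (M _ _ (M _ _ _ (pf l)) (pf' l')).
by move: hab; rewrite /ord_ge /= opprK.
Qed.

Lemma res2_filtration a b u v h : filtration a u ->
  filtration b v -> ord_ge (- (a + b)) h -> res2 (wedge Om2 u v) h = 0.
Proof.
move=> au bv hab; rewrite res2E addmapDE addmapNE (res_form_filtration au bv) //.
by rewrite (res_form_filtration bv au) ?subrr // addrC.
Qed.

(** * The filtration of 1-forms by powers of [z] *)

Lemma filtration_kd g : p g -> filtration 0 (kd OmL g).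
Proof.
move=> pg; exists (kd OmL g); last by rewrite expr0z scale1r.
exists 1%N, (fun=> 1), (fun=> g); split=> // [_|]; first exact: point1 p_rational.
by rewrite big_ord1 scale1r.
Qed.

Lemma filtrationD n u v : filtration n u -> filtration n v ->
  filtration n (u + v).
Proof.
move=> [_ [a [f [g [pf pg ->]]]] ->] [_ [b [f' [g' [pf' pg' ->]]]] ->].
rewrite -scalerDr; eexists; last by [].
exists (a + b)%N, (fun l => match split l with inl x => f x | inr x => f' x end),
  (fun l => match split l with inl x => g x | inr x => g' x end).
split=> [l|l|]; try by case: split.
rewrite big_split_ord /=; congr (_ + _); apply: eq_bigr => l _.
  by rewrite (unsplitK (inl l)).
by rewrite (unsplitK (inr l)).
Qed.

Lemma filtration0 n : filtration n (0 : OmL).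
Proof.
exists 0; last by rewrite scaler0.
exists 0%N, (fun=> 0), (fun=> 0); split; try by case.
by rewrite big_ord0.
Qed.

Lemma filtrationZ a n c u : ord_ge a c -> filtration n u ->
  filtration (a + n) (c *: u).
Proof.
move=> ac [_ [b [f [g [pf pg ->]]]] ->].
exists ((c * z ^ (- a)) *: (\sum_(l < b) f l *: kd OmL (g l))).
  exists b, (fun l => c * z ^ (- a) * f l), g; split=> // [l|].
    exact: pointM p_rational _ _ ac (pf l).
  by rewrite scaler_sumr; apply: eq_bigr => l _; rewrite scalerA.
rewrite !scalerA; congr (_ *: _); rewrite expfzDr //.
by rewrite -invr_expz; field; exact: expfz_neq0.
Qed.

Lemma filtration_sum n I (s : seq I) (P : pred I) (F : I -> OmL) :
  (forall l, P l -> filtration n (F l)) ->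
  filtration n (\sum_(l <- s | P l) F l).
Proof. by move=> Fn; apply: big_ind => //; [exact: filtration0|exact: filtrationD]. Qed.

Lemma filtration_mono a b u : b <= a -> filtration a u ->
  filtration b u.
Proof.
move=> ba /(@filtrationZ (b - a) a 1); rewrite subrK scale1r; apply.
rewrite -(expr0z z); apply: (ord_ge_mono p_rational z_parameter (a := 0)); first by lia.
exact: (ord_ge_expz p_rational z_parameter).
Qed.

Lemma filtration_phi w : filtration 0 (phi w).
Proof.
elim/kaehler_ind: w => [|b w w' hw hw'|g].
- by rewrite raddf0; exact: filtration0.
- rewrite kmapP; apply: filtrationD => //; rewrite -[0]addr0; apply: filtrationZ => //.
  by rewrite ord_ge0; exact: (point_const p_rational).
by rewrite kmap_d; exact: (filtration_kd (point_const p_rational _)).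
Qed.

(** By d(z^n w) = n z^(n-1) dz /\ w + z^n dw the differential costs one order, hence the bound 1 -
    n. *)
Lemma res2_d_filtration n u h : filtration n u -> ord_ge (1 - n) h ->
  res2 (dR u) h = 0.
Proof.
move=> [w [a [f [g [pf pg wE]]] ->]] hn.
have fw : filtration 0 w.
  rewrite wE; apply: filtration_sum => l _; rewrite -[0]addr0.
  by apply: filtrationZ; [rewrite ord_ge0; exact: pf|exact: filtration_kd].
have hz : ord_ge 0 (h * z ^ (n - 1)).
  have := ord_geM p_rational z_parameter hn (ord_ge_expz p_rational z_parameter (n - 1)).
  by congr (ord_ge _ _); lia.
have h1 c : ord_ge 0 (h * (c%:~R * z ^ (n - 1))).
  rewrite mulrCA; apply: (ord_geMp p_rational) => //.
  by rewrite -(rmorph_int j); exact: (point_const p_rational).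
rewrite ext_dZ kd_exprz // wedgeZl raddfD /= linearZ /=.
rewrite (res2_filtration (filtration_kd (pointz z_parameter)) fw) ?add0r ?oppr0; last exact: h1.
rewrite linearZ /= wE !raddf_sum /= addmap_sumE; apply: big1 => l _.
rewrite ext_dZ ext_d_exact scaler0 addr0.
rewrite (res2_filtration (filtration_kd (pf l)) (filtration_kd (pg l))) //.
rewrite addr0 oppr0 -[n](subrK 1) expfzDr // expr1z mulrA mulrC.
by apply: (ord_geMp p_rational) => //; exact: (pointz z_parameter).
Qed.

End ResidueForm.

(** * Traces of commutators *)

(** Regrouping by total degree u = s + t, as in a Cauchy product. *)
Lemma triangular_sum (V : zmodType) (F : nat -> nat -> V) n :
  \sum_(s < n.+1) \sum_(t < (n - s).+1) F s t =
  \sum_(u < n.+1) \sum_(s < u.+1) F s (u - s)%N.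
Proof.
elim: n => [|n IH]; first by rewrite !big_ord1.
rewrite [RHS]big_ord_recr -IH /= [\sum_(s < n.+2) F _ _]big_ord_recr /=.
rewrite big_ord_recr /= addrA subnn big_ord1; congr (_ + _).
rewrite -big_split; apply: eq_bigr => s _ /=.
have s_le : (s <= n)%N by rewrite -ltnS.
by rewrite subSn // big_ord_recr.
Qed.

Section TraceCommutator.
Variables (F : fieldType) (M : lmodType F) (r : nat).
Implicit Types (A Q : 'M[F]_r) (W : 'M[M]_r).

Lemma tr_lmulformE A W : \tr (lmulform A W) = \sum_a \sum_c A a c *: W c a.
Proof. by apply: eq_bigr => a _; rewrite mxE. Qed.

(** Cyclicity of the trace, written out in entries because those of [W] lie in a module. *)
Lemma tr_lmulform_comm Q A W :
  \tr (lmulform Q (commform A W)) =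
  \tr (lmulform (Q *m A) W) - \tr (lmulform (A *m Q) W).
Proof.
rewrite !tr_lmulformE -sumrB.
transitivity (\sum_a \sum_c \sum_e (Q a c * A c e) *: W e a -
              \sum_a \sum_c \sum_e (Q a c * A e a) *: W c e).
  rewrite -sumrB; apply: eq_bigr => a _; rewrite -sumrB; apply: eq_bigr => c _.
  rewrite !mxE scalerBr !scaler_sumr; congr (_ - _);
    by apply: eq_bigr => e _; rewrite scalerA.
rewrite sumrB; congr (_ - _).
  apply: eq_bigr => a _; rewrite exchange_big; apply: eq_bigr => e _.
  by rewrite mxE scaler_suml.
rewrite [RHS]exchange_big [LHS]exchange_big /=.
under eq_bigr do rewrite exchange_big /=.
apply: eq_bigr => c _; apply: eq_bigr => e _.
by rewrite mxE scaler_suml; apply: eq_bigr => a _; rewrite mulrC.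
Qed.

Lemma tr_lmulformD A A' W :
  \tr (lmulform (A + A') W) = \tr (lmulform A W) + \tr (lmulform A' W).
Proof.
rewrite !tr_lmulformE -big_split; apply: eq_bigr => a _.
by rewrite -big_split; apply: eq_bigr => c _; rewrite mxE scalerDl.
Qed.

Lemma tr_lmulform_suml I (s : seq I) (P : pred I) (A : I -> 'M[F]_r) W :
  \tr (lmulform (\sum_(l <- s | P l) A l) W) =
  \sum_(l <- s | P l) \tr (lmulform (A l) W).
Proof.
apply: (big_rec2 (fun A x => \tr (lmulform A W) = x)) => [|l A' x _ <-].
  by rewrite tr_lmulformE big1 // => a _; rewrite big1 // => c _; rewrite mxE scale0r.
exact: tr_lmulformD.
Qed.

Lemma tr_lmulform0 A : \tr (lmulform A (0 : 'M[M]_r)) = 0.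
Proof.
by rewrite tr_lmulformE big1 // => a _; rewrite big1 // => c _; rewrite mxE scaler0.
Qed.

Lemma tr_lmulform_sumr I (s : seq I) (P : pred I) A (W : I -> 'M[M]_r) :
  \tr (lmulform A (\sum_(l <- s | P l) W l)) =
  \sum_(l <- s | P l) \tr (lmulform A (W l)).
Proof.
apply: (big_rec2 (fun W x => \tr (lmulform A W) = x)) => [|l W' x _ <-].
  exact: tr_lmulform0.
rewrite !tr_lmulformE -big_split; apply: eq_bigr => a _.
by rewrite -big_split; apply: eq_bigr => c _; rewrite mxE scalerDr.
Qed.

Lemma tr_lmulformZ c A W : \tr (lmulform (c *: A) W) = c *: \tr (lmulform A W).
Proof.
rewrite !tr_lmulformE scaler_sumr; apply: eq_bigr => a _.
by rewrite scaler_sumr; apply: eq_bigr => b _; rewrite mxE scalerA.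
Qed.

(* With G = sum_s G_s z^s, H = sum_s H_s z^s and Q = adj G, the matrices Q and G
   commute, so Tr (Q [G, H]) = 0; the lowest possibly nonzero coefficient of
   [G, H] is that of z^n. *)
Lemma tr_adj_comm (G : nat -> 'M[F]_r) (H : nat -> 'M[M]_r) (n : nat) :
  (forall t, (t < n)%N -> \sum_(s < t.+1) commform (G s) (H (t - s)%N) = 0) ->
  \tr (lmulform (\adj (G 0%N)) (\sum_(s < n.+1) commform (G s) (H (n - s)%N))) = 0.
Proof.
move=> GH0.
(* Only coefficients up to z^n matter, so G is truncated to a matrix of polynomials. *)
pose Gz : 'M[{poly F}]_r := \matrix_(a, b) \poly_(s < n.+1) G s a b.
pose C (l : nat) (A : 'M[{poly F}]_r) : 'M[F]_r := \matrix_(a, b) (A a b)`_l.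
have CG l : (l <= n)%N -> C l Gz = G l.
  by move=> ln; apply/matrixP => a b; rewrite !mxE coef_poly ltnS ln.
have C0adj : C 0%N (\adj Gz) = \adj (G 0%N).
  (* Evaluation at 0 is a ring morphism, hence commutes with the adjugate. *)
  have C0 (A : 'M[{poly F}]_r) : C 0%N A = map_mx (horner_eval 0) A.
    by apply/matrixP => a b; rewrite !mxE /horner_eval horner_coef0.
  by rewrite C0 map_mx_adj -C0 CG.
have CM l (A A' : 'M[{poly F}]_r) : C l (A *m A') = \sum_(s < l.+1) C s A *m C (l - s)%N A'.
  apply/matrixP => a b; rewrite mxE summxE mxE coef_sum.
  under eq_bigr do rewrite coefM.
  rewrite exchange_big; apply: eq_bigr => s _; rewrite mxE.
  by apply: eq_bigr => c _; rewrite !mxE.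
have CMr l (A A' : 'M[{poly F}]_r) : C l (A *m A') = \sum_(s < l.+1) C (l - s)%N A *m C s A'.
  rewrite CM (reindex_inj rev_ord_inj); apply: eq_bigr => s _ /=.
  by rewrite subSS subKn // -ltnS.
pose Q := \adj Gz.
(* The coefficient of z^n in Tr (Q [G, H]). Its terms with s > 0 involve lower coefficients of
   [G, H], which vanish by hypothesis. *)
pose S := \sum_(s < n.+1) \tr (lmulform (C s Q)
  (\sum_(t < (n - s).+1) commform (G t) (H (n - s - t)%N))).
have <- : S = \tr (lmulform (\adj (G 0%N))
    (\sum_(s < n.+1) commform (G s) (H (n - s)%N))).
  rewrite /S [LHS]big_ord_recl /= subn0 C0adj [X in _ + X]big1 ?addr0 // => s _.
  rewrite GH0; last by rewrite /bump /=; have := ltn_ord s; lia.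
  exact: tr_lmulform0.
pose f s t := \tr (lmulform (C s Q) (commform (G t) (H (n - (s + t))%N))).
have -> : S = \sum_(s < n.+1) \sum_(t < (n - s).+1) f s t.
  apply: eq_bigr => s _; rewrite tr_lmulform_sumr; apply: eq_bigr => t _.
  by rewrite /f subnDA.
rewrite triangular_sum big1 // => u _.
(* For fixed u the terms assemble to the z^u coefficient of Q G - G Q, paired with H_(n-u). *)
have -> : \sum_(s < u.+1) f s (u - s)%N =
    \tr (lmulform (C u (Q *m Gz)) (H (n - u)%N)) -
    \tr (lmulform (C u (Gz *m Q)) (H (n - u)%N)).
  rewrite (CM _ Q) (CMr _ Gz) !tr_lmulform_suml -sumrB; apply: eq_bigr => s _.
  have su : (s <= u)%N by rewrite -ltnS.
  have un : (u - s <= n)%N by apply: leq_trans (leq_subr _ _) _; rewrite -ltnS.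
  by rewrite /f subnKC // tr_lmulform_comm !CG // (leq_trans su) // -ltnS.
by rewrite mul_adj_mx mul_mx_adj subrr.
Qed.
End TraceCommutator.

(** * The curvature matrix *)

Section Curvature.
Variables (k K L : fieldType) (i : {rmorphism k -> K}) (j : {rmorphism K -> L}).
Variables (OmL : kaehler (j \o i)).
Variables (Om2 : exterior_square OmL) (dR : exterior_derivative Om2) (r : nat).
Variable nabla : {additive 'cV[L]_r -> 'cV[OmL]_r}.
Hypothesis nabla_connection : connection nabla.

Definition curvature_form (A : 'M[OmL]_r) a b : Om2 :=
  dR (A a b) + \sum_c wedge Om2 (A a c) (A c b).

Lemma connection_col (v : 'cV[L]_r) a : nabla v a 0 =
  kd OmL (v a 0) + \sum_c v c 0 *: nabla (delta_mx c 0) a 0.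
Proof.
rewrite {1}[v]matrix_sum_delta; under eq_bigr do rewrite big_ord1.
rewrite raddf_sum summxE.
under eq_bigr do rewrite nabla_connection !mxE andbT.
rewrite big_split /=; congr (_ + _); rewrite (bigD1 a) //= eqxx scale1r big1 ?addr0 //.
by move=> c /negPf ca; rewrite eq_sym ca scale0r.
Qed.

(** [curvature] is written in the standard basis. Passing to [B] creates terms dB /\ A both from the
    Leibniz rule and from the change of connection matrix, and these cancel. *)
Lemma curvature_matrix (B : 'M[L]_r) (A : 'M[OmL]_r) a b :
  connection_matrix nabla B A ->
  curvature dR nabla (col b B) a 0 = \sum_c B a c *: curvature_form A c b.
Proof.
move=> A_matrix.
have nablaB e c : nabla (col c B) e 0 = \sum_d B e d *: A d c.
  by rewrite A_matrix mxE; apply: eq_bigr => d _; rewrite mxE.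
(* The gauge formula Gamma B = B A - dB, with Gamma the connection matrix in the standard basis. *)
have change_basis c : \sum_e B e c *: nabla (delta_mx e 0) a 0 =
    \sum_e B a e *: A e c - kd OmL (B a c).
  rewrite -nablaB connection_col !mxE addrAC subrr add0r.
  by apply: eq_bigr => e _; rewrite mxE.
rewrite mxE nablaB raddf_sum /=; under eq_bigr do rewrite ext_dZ.
have -> : \sum_e wedge Om2 (nabla (col b B) e 0) (nabla (delta_mx e 0) a 0) =
    \sum_c wedge Om2 (A c b) (\sum_e B e c *: nabla (delta_mx e 0) a 0).
  under [RHS]eq_bigr do rewrite wedge_sumr.
  rewrite exchange_big /=; apply: eq_bigr => e _; rewrite nablaB wedge_suml.
  by apply: eq_bigr => c _; rewrite wedgeZl wedgeZr.
under [X in _ - X]eq_bigr => c _.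
  rewrite change_basis wedgeDr -scaleN1r wedgeZr scaleN1r -wedgeC [wedge _ (A c b) _]wedgeC.
  over.
rewrite -sumrN -big_split /=.
transitivity (\sum_c B a c *: dR (A c b) +
    \sum_c \sum_e B a e *: wedge Om2 (A e c) (A c b)).
  rewrite -big_split; apply: eq_bigr => c _ /=.
  have -> : wedge Om2 (\sum_e B a e *: A e c) (A c b) =
      \sum_e B a e *: wedge Om2 (A e c) (A c b).
    by rewrite wedge_suml; apply: eq_bigr => e _; rewrite wedgeZl.
  by rewrite opprD opprK [X in X + _]addrC -addrA [X in _ + X]addrC subrK.
rewrite [X in _ + X]exchange_big -big_split; apply: eq_bigr => c _ /=.
by rewrite scalerDr scaler_sumr.
Qed.
End Curvature.

(** * Commutator relations from verticality *)

Section LeadingCoefficients.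
Variables (k K L : fieldType) (i : {rmorphism k -> K}) (j : {rmorphism K -> L}).
Variables (p : set L) (z : L).
Hypotheses (p_rational : rational_point j p) (z_parameter : local_parameter p z).
Variables (OmK : kaehler i) (OmL : kaehler (j \o i)) (phi : kaehler_map j OmK OmL).
Variables (Om2 : exterior_square OmL) (dR : exterior_derivative Om2) (r : nat).

Let z_neq0 : z != 0. Proof. by case: z_parameter. Qed.

Local Notation ord_ge := (ord_ge p z).
Local Notation const_coef := (const_coef j p z).
Local Notation res_form := (res_form p_rational z_parameter OmK).
Local Notation res2 := (res2 p_rational z_parameter OmK Om2).
Local Notation filtration := (@omega_filtration k K L i j OmL p z).

(** Verticality kills the residues of the entries of B (dA + A /\ A); as [res2] is linear over [L],
    multiplying by the inverse of [B] isolates each entry of the curvature matrix. *)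
Lemma res2_curvature_form (nabla : {additive 'cV[L]_r -> 'cV[OmL]_r}) B A a b :
  connection nabla -> vertical phi dR nabla -> connection_matrix nabla B A ->
  B \in unitmx -> res2 (curvature_form dR A a b) = 0.
Proof.
move=> nabla_connection nabla_vertical A_matrix B_unit.
have E c : \sum_d B c d *: res2 (curvature_form dR A d b) = 0.
  transitivity (res2 (curvature dR nabla (col b B) c 0)); last first.
    by move: (nabla_vertical (col b B) c); exact: res2_base.
  rewrite (curvature_matrix dR nabla_connection c b A_matrix) raddf_sum /=.
  by apply: eq_bigr => d _; rewrite linearZ.
transitivity (\sum_c invmx B a c *: \sum_d B c d *: res2 (curvature_form dR A d b)).
  under eq_bigr do rewrite scaler_sumr.
  rewrite exchange_big /=.
  transitivity (\sum_d (invmx B *m B) a d *: res2 (curvature_form dR A d b)).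
    rewrite mulVmx // (bigD1 a) //= mxE eqxx scale1r big1 ?addr0 // => d /negPf da.
    by rewrite mxE eq_sym da scale0r.
  apply: eq_bigr => d _; rewrite mxE scaler_suml.
  by apply: eq_bigr => c _; rewrite scalerA.
by apply: big1 => c _; rewrite E scaler0.
Qed.

Lemma filtration_monomial e c w : filtration e ((j c * z ^ e) *: phi w).
Proof.
rewrite -[X in filtration X]addr0; apply: filtrationZ => //.
  exact: ord_ge_monomial.
exact: filtration_phi.
Qed.

(* The exponents l - (m - 1) are those of the eta-part of the local equation. *)
Definition base_part (N : nat) (m : int) (w : nat -> OmK) : OmL :=
  \sum_(l < N) z ^ (l%:Z - (m - 1)) *: phi (w l).

(** Only dz in the first slot against the base part in the second survives. The exponent is l - (m -
    1), plus 1 for the factor [z] in [res_form_z_phi]. *)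
Lemma res_form_parts N m x y w w' h :
  res_form (x *: kd OmL z + base_part N m w) (y *: kd OmL z + base_part N m w') h =
  \sum_(l < N) const_coef (h * x * z ^ (l%:Z - m + 2)) *: w' l.
Proof.
rewrite res_formDl [res_form (base_part _ _ _) _]res_form_suml.
rewrite [X in _ + X]big1 ?addr0 => [|l _]; last by rewrite res_formZl res_form_phil scaler0.
rewrite linearD /= [res_form _ (y *: _)]linearZ /= res_formZl res_form_zz !scaler0 add0r.
rewrite res_formZl addmapZE raddf_sum addmap_sumE.
apply: eq_bigr => l _ /=; rewrite linearZ /= res_form_z_phi.
rewrite -[_ * z]mulrA -[z ^ _ * z]/(z ^ _ * z ^ 1) -expfzDr //.
by congr (const_coef (_ * _ ^ _) *: _); lia.
Qed.


(** Since dz /\ dz = 0, only z^e dc /\ dz remains, which saves one order over [res2_d_filtration].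
    This is needed below for the term dz / z^m when t = m - 2. *)
Lemma res2_d_monomial_dz c e h : ord_ge (- e) h ->
  res2 (dR ((j c * z ^ e) *: kd OmL z)) h = 0.
Proof.
move=> he; rewrite ext_dZ ext_d_exact scaler0 addr0 kdM kd_exprz // scalerA.
rewrite wedgeDl wedgeZl raddfD /= linearZ /= res2E subrr add0r.
rewrite -(kmap_d phi) -[z ^ e]mul1r -(rmorph1 j).
have dz : filtration 0 (kd OmL z) by exact: (filtration_kd _ p_rational _ (pointz z_parameter)).
by apply: (res2_filtration _ _ _ _ (filtration_monomial e 1 _) dz); rewrite addr0.
Qed.

Lemma const_coef_sum I (s : seq I) (P : pred I) (f : I -> L) :
  const_coef (\sum_(l <- s | P l) f l) = \sum_(l <- s | P l) const_coef (f l).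
Proof.
apply: (big_morph _ (const_coefD p_rational z_parameter)).
by apply: (addrI (const_coef 0)); rewrite -const_coefD // !addr0.
Qed.

(** These sums are the coefficients of dz / z^(2m - 1 - t) in A /\ A; in this range dA contributes
    nothing. *)
Lemma local_commutators (A : 'M[OmL]_r) (m : nat) (g : int -> 'M[K]_r)
    (eta : int -> 'M[OmK]_r) :
  local_equation phi p z A m g eta ->
  (forall a b, res2 (curvature_form dR A a b) = 0) ->
  forall t, (t.+1 < m)%N ->
    \sum_(s < t.+1) commform (g (m%:Z - s%:Z)) (eta (m%:Z - 1 - (t - s)%N%:Z)) = 0.
Proof.
move=> A_equation A_flat t tm.
(* With 2m terms the remainder lies in z^m Omega, which compensates the pole of order m of the
   truncation. *)
pose N := (2 * m)%N.
pose x a b := \sum_(l < N) j (g (m%:Z - l%:Z) a b) * z ^ (l%:Z - m%:Z).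
pose w a b (l : nat) := eta (m%:Z - 1 - l%:Z) a b.
pose P a b := x a b *: kd OmL z + base_part N m (w a b).
pose R a b := A a b - P a b.
(* Residues against this h pick out the coefficient of dz / z^(2m - 1 - t). *)
pose h := z ^ ((2 * m)%:Z - 2 - t%:Z).
have h_ord e : e <= (2 * m)%:Z - 2 - t%:Z -> ord_ge e h.
  by move=> eh; apply: (ord_ge_mono p_rational z_parameter eh); exact: (ord_ge_expz p_rational).
have R_fil a b : filtration m (R a b).
  have := A_equation N a b; rewrite (_ : N%:Z - m%:Z = m); last by lia.
  by rewrite /R /P (opprD (x a b *: _)) [A a b + (_ + _)]addrA /x scaler_suml.
have X_fil a b : filtration (- m%:Z) (x a b *: kd OmL z).
  rewrite -[- _]addr0; apply: filtrationZ => //.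
    apply: (ord_ge_sum p_rational) => l _; apply: (ord_ge_monomial p_rational) => //; lia.
  by apply: (filtration_kd _ p_rational); exact: (pointz z_parameter).
have Y_fil a b : filtration (1 - m%:Z) (base_part N m (w a b)).
  apply: filtration_sum => l _.
  rewrite -[z ^ _]mul1r -(rmorph1 j).
  apply: (filtration_mono p_rational z_parameter _ (filtration_monomial _ _ _)); lia.
have P_fil a b : filtration (- m%:Z) (P a b).
  apply: filtrationD => //.
  by apply: (filtration_mono p_rational z_parameter _ (Y_fil a b)); lia.
have AE a b : A a b = P a b + R a b by rewrite /R addrC subrK.
have wedgeDD u u' v v' : res2 (wedge Om2 (u + u') (v + v')) h =
    res2 (wedge Om2 u v) h + res2 (wedge Om2 u v') h +
    (res2 (wedge Om2 u' v) h + res2 (wedge Om2 u' v') h).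
  by rewrite wedgeDl !wedgeDr !raddfD.
have dD u v : res2 (dR (u + v)) h = res2 (dR u) h + res2 (dR v) h by rewrite !raddfD.
have wedgeA a b c : res2 (wedge Om2 (A a c) (A c b)) h = res2 (wedge Om2 (P a c) (P c b)) h.
  rewrite !AE wedgeDD.
  rewrite (res2_filtration _ _ _ _ (P_fil a c) (R_fil c b)); last by apply: h_ord; lia.
  rewrite (res2_filtration _ _ _ _ (R_fil a c) (P_fil c b)); last by apply: h_ord; lia.
  rewrite (res2_filtration _ _ _ _ (R_fil a c) (R_fil c b)); last by apply: h_ord; lia.
  by rewrite !addr0.
(* From t + 1 < m follows 2m - 2 - t >= m, the order of [h] that both the dz-part and the base part
   require. *)
have dA a b : res2 (dR (A a b)) h = 0.
  rewrite AE dD (res2_d_filtration _ _ _ _ (R_fil a b)) ?addr0; last by apply: h_ord; lia.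
  rewrite dD (res2_d_filtration _ _ _ _ (Y_fil a b)) ?addr0; last by apply: h_ord; lia.
  rewrite scaler_suml !raddf_sum addmap_sumE big1 // => l _ /=.
  by apply: res2_d_monomial_dz; apply: h_ord; lia.
have coefx (y : nat -> OmK) a b :
    \sum_(l < N) const_coef (h * x a b * z ^ (l%:Z - m%:Z + 2)) *: y l =
    \sum_(s < t.+1) g (m%:Z - s%:Z) a b *: y (t - s)%N.
  (* The exponents of [h], of the l'-th term of [x] and of the last factor add up to l' + l - t. *)
  have cE (l : nat) : const_coef (h * x a b * z ^ (l%:Z - m%:Z + 2)) =
      \sum_(l' < N) if (l' + l == t)%N then g (m%:Z - l'%:Z) a b else 0.
    rewrite mulr_sumr mulr_suml const_coef_sum; apply: eq_bigr => l' _.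
    rewrite mulrCA -mulrA -!expfzDr // const_coef_monomial //.
    by congr (if _ then _ else _); lia.
  under eq_bigr do rewrite cE scaler_suml.
  rewrite exchange_big (big_ord_widen N (fun s => g (m%:Z - s%:Z) a b *: y (t - s)%N)) /=; last by lia.
  rewrite [RHS]big_mkcond; apply: eq_bigr => s _; case: ifP => st.
    have ts : (t - s < N)%N by lia.
    rewrite (bigD1 (Ordinal ts)) //= subnKC // eqxx big1 ?addr0 // => l l_neq.
    rewrite ifN ?scale0r //; apply: contra l_neq => /eqP sl; apply/eqP; apply: val_inj => /=; lia.
  rewrite big1 // => l _; rewrite ifN ?scale0r //; lia.
apply/matrixP => a b.
have /(congr1 (fun u : addmap L OmK => u h)) := A_flat a b.
rewrite /curvature_form raddfD raddf_sum /= dA add0r addmap_sumE => A_flat_h.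
have PP_flat : \sum_c res2 (wedge Om2 (P a c) (P c b)) h = 0.
  by rewrite -[RHS]A_flat_h; apply: eq_bigr => c _; exact/esym/wedgeA.
rewrite [RHS]mxE -PP_flat summxE.
transitivity (\sum_c \sum_(s < t.+1)
    (g (m%:Z - s%:Z) a c *: w c b (t - s)%N - g (m%:Z - s%:Z) c b *: w a c (t - s)%N)).
  by rewrite exchange_big; apply: eq_bigr => s _; rewrite !mxE sumrB.
(* The two terms of the antisymmetrised residue give the two halves of the commutator. *)
apply: eq_bigr => c _; rewrite res2E addmapDE addmapNE !res_form_parts !coefx.
by rewrite -sumrB.
Qed.

End LeadingCoefficients.

(** * The trace identity *)

Theorem proposition3p8
  (k K L : fieldType) (i : {rmorphism k -> K}) (j : {rmorphism K -> L})
  (char0 : [pchar k] =i pred0)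
  (K_function_field : fin_gen_field i)
  (X_curve : curve_function_field j)
  (OmK : kaehler i) (OmL : kaehler (j \o i)) (phi : kaehler_map j OmK OmL)
  (Om2 : exterior_square OmL) (dR : exterior_derivative Om2)
  (r : nat) (E : set L -> set 'cV[L]_r)
  (E_bundle : vector_bundle j E)
  (nabla : {additive 'cV[L]_r -> 'cV[OmL]_r})
  (nabla_connection : connection nabla)
  (nabla_vertical : vertical phi dR nabla)
  (nabla_admissible : admissible E nabla)
  (p : set L) (p_rational : rational_point j p)
  (z : L) (z_parameter : local_parameter p z)
  (B : 'M[L]_r) (B_basis : local_basis E p B)
  (A : 'M[OmL]_r) (A_matrix : connection_matrix nabla B A)
  (m : nat) (g : int -> 'M[K]_r) (eta : int -> 'M[OmK]_r)
  (A_equation : local_equation phi p z A m g eta)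
  (p_admissible : admissible_leading m (g m%:Z)) :
  \tr (lmulform (invmx (g m%:Z))
         (\sum_(s < m) commform (g (m%:Z - s%:Z)) (eta s%:Z))) = 0.
Proof.
have gm_unit : g m%:Z \in unitmx.
  (* For m = 1, invertibility is the absence of the eigenvalue 0. *)
  case: p_admissible => [[] //|[m1 no_eigen]].
  have := no_eigen 0%N; rewrite /eigenvalue negbK /eigenspace raddf0 subr0.
  by rewrite kermx_eq0 row_free_unit.
have m_gt0 : (0 < m)%N by case: p_admissible => [[/ltnW]|[->]].
have A_flat a b : res2 p_rational z_parameter OmK Om2 (curvature_form dR A a b) = 0.
  apply: (res2_curvature_form _ _ _ _ nabla_connection nabla_vertical A_matrix).
  by case: B_basis.
(* Reversed indexing makes the sum in question the z^(m - 1) coefficient of [G, H]. *)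
pose H (s : nat) := eta (m%:Z - 1 - s%:Z).
have HE : \sum_(s < m) commform (g (m%:Z - s%:Z)) (eta s%:Z) =
    \sum_(s < m.-1.+1) commform (g (m%:Z - s%:Z)) (H (m.-1 - s)%N).
  rewrite prednK //; apply: eq_bigr => s _; congr (commform _ (eta _)).
  by have := ltn_ord s; lia.
have tr0 : \tr (lmulform (\adj (g m%:Z)) (\sum_(s < m.-1.+1)
    commform (g (m%:Z - s%:Z)) (H (m.-1 - s)%N))) = 0.
  (* The coefficients with t < m - 1 vanish by the commutator relations; for m = 1 there are
     none. *)
  have := @tr_adj_comm K OmK r (fun s => g (m%:Z - s%:Z)) H m.-1.
  rewrite subr0; apply=> t tm.
  by apply: (local_commutators A_equation A_flat); rewrite -ltn_predRL.
by rewrite HE /invmx gm_unit tr_lmulformZ tr0 scaler0.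
Qed.
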